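(* For every integer $k\geq 2$ there is a constant $C_k$ such that for every positive integer $n$ we have $\hat{r}(P_n^k)\leq C_k n$; that is, $\hat{r}(P_n^k)=O(n)$ as $n\to\infty$.
   Context: For graphs $G,H$, write $G\rightarrow H$ if every $2$-colouring of the edges of $G$ contains a monochromatic copy of $H$. The size-Ramsey number of $H$ is $\hat{r}(H)=\min\{|E(G)|\colon G\rightarrow H\}$. $P_n$ denotes the path on $n$ vertices. For a graph $H$ and integer $k$, the $k$th power $H^k$ is the graph on $V(H)$ in which $u,v$ are adjacent if and only if their distance in $H$ is at most $k$ (and at least 1). *)

(* Defs.v *)
From mathcomp Require Import all_boot.

Set Implicit Arguments.
Unset Strict Implicit.
Unset Printing Implicit Defensive.

Record sgraph := SGraph {
  vertex :> finType;
  adj : rel vertex;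
  adj_sym : symmetric adj;
  adj_irr : irreflexive adj
}.
Arguments adj {s} x y.

Definition edges (G : sgraph) : {set {set G}} :=
  [set [set x; y] | x in G, y in G & adj x y].

Section Distance.
Variable G : sgraph.
Implicit Types u v : G.

Definition walk (d : nat) u v : bool :=
  [exists p : d.-tuple G, path adj u p && (last u p == v)].

(* A shortest walk visits distinct vertices, so it has length less than #|G|;
   None stands for infinite distance (no walk at all). *)
Definition dist u v : option nat :=
  let d := find (fun d => walk d u v) (iota 0 #|G|) in
  if d < #|G| then Some d else None.

Lemma walk_sym d : symmetric (walk d).
Proof.
suff imp u v : walk d u v -> walk d v u by move=> u v; apply/idP/idP; apply: imp.
case/existsP=> p /andP[pp /eqP <-]; apply/existsP.
have sz : size (rev (belast u p)) == d by rewrite size_rev size_belast size_tuple.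
exists (Tuple sz); rewrite /= rev_path.
rewrite (eq_path (e' := adj)); last by move=> x y; exact: adj_sym.
rewrite pp /=; case: (p : seq G) => [//|x s] /=.
by rewrite rev_cons last_rcons.
Qed.

Lemma dist_sym u v : dist u v = dist v u.
Proof.
by rewrite /dist (eq_find (a2 := fun d => walk d v u)) // => d; exact: walk_sym.
Qed.

Lemma dist_refl u : dist u u = Some 0.
Proof.
have G0 : 0 < #|G| by apply/card_gt0P; exists u.
rewrite /dist -(prednK G0) /=.
suff -> : walk 0 u u by [].
by apply/existsP; exists [tuple]; rewrite /= eqxx.
Qed.

End Distance.

Section Power.
Variables (H : sgraph) (k : nat).

Definition power_adj : rel H := fun u v =>
  if dist u v is Some d then 1 <= d <= k else false.

Lemma power_adj_sym : symmetric power_adj.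
Proof. by move=> u v; rewrite /power_adj dist_sym. Qed.

Lemma power_adj_irr : irreflexive power_adj.
Proof. by move=> u; rewrite /power_adj dist_refl. Qed.

Definition power : sgraph := SGraph power_adj_sym power_adj_irr.

End Power.

Section Path.
Variable n : nat.

Definition path_adj : rel 'I_n := fun i j => (i.+1 == j) || (j.+1 == i).

Lemma path_adj_sym : symmetric path_adj.
Proof. by move=> i j; rewrite /path_adj orbC. Qed.

Lemma path_adj_irr : irreflexive path_adj.
Proof. by move=> i; rewrite /path_adj orbb gtn_eqF. Qed.

Definition path_graph : sgraph := SGraph path_adj_sym path_adj_irr.

End Path.

(* The copy is a not necessarily induced subgraph.  A colouring is total on
   {set G}, but only its values on the edges of G matter. *)
Definition mono_copy (G H : sgraph) (c : {set G} -> bool) : Prop :=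
  exists (b : bool) (f : H -> G), injective f /\
    forall u v : H, adj u v -> adj (f u) (f v) /\ c [set f u; f v] = b.

Definition arrows (G H : sgraph) : Prop :=
  forall c : {set G} -> bool, mono_copy H c.

(* r = min { |E(G)| : G -> H }, attainment of the minimum included. *)
Definition is_size_ramsey (H : sgraph) (r : nat) : Prop :=
  (exists G : sgraph, arrows G H /\ #|edges G| = r) /\
  (forall G : sgraph, arrows G H -> r <= #|edges G|).

(* Main.v *)
Require Import Defs.
From mathcomp Require Import all_boot zify.
From Stdlib Require Import Classical_Prop.

Set Implicit Arguments.
Unset Strict Implicit.
Unset Printing Implicit Defensive.

(** The host graph is the blow-up, with cliques of constant size [t], of the
    "reachable in at most [k] steps" graph of [d] random functions on [a * n]
    points: the number of edges is linear because out-degrees are bounded, and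
    any two sets of [n] points are joined by an arrow.  Given a colouring, take a
    large monochromatic clique in every blob and keep the blobs [W] of the
    majority colour [b].  Call two adjacent blobs linked if there is a [b]-coloured
    K_{2k,2k} between their cliques.  A path of [n + 1] linked blobs yields a copy
    in colour [b].  Otherwise depth-first search, iterated, gives [2 ^ k > k] large
    classes of blobs with no links between distinct classes; depth-first search
    along arrows finds a directed path visiting the classes cyclically, so that
    any two of its points at distance at most [k] are adjacent and unlinked.
    By Kovari-Sos-Turan, colour [b] is sparse between unlinked cliques, and one
    vertex per blob can be chosen greedily to form a copy in the other colour. *)

(** * Depth-first search: long paths or separated sets *)

(* [A] is the set of finished vertices and [U] the stack of a depth-first search
   inside [W], stopped as soon as [Q] holds of the finished vertices. *)
Lemma dfs_separation (T : finType) (e : rel T) (W : {set T})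
    (Q : pred {set T}) (m : nat) :
  0 < m -> ~~ Q set0 -> Q W ->
  (exists p : seq T,
     [/\ sorted e p, uniq p, {subset p <= W} & size p = m]) \/
  (exists A U : {set T},
     [/\ A \subset W, Q A, exists2 x, x \in A & ~~ Q (A :\ x), #|U| < m
       & forall x y, x \in A -> y \in W :\: (A :|: U) -> ~~ e x y]).
Proof.
move=> m0 Q0 QW; set goal := (_ \/ _).
pose st (A : {set T}) p := [/\ A \subset W, ~~ Q A, sorted e (rev p), uniq p &
  [/\ {subset p <= W}, forall x, x \in p -> x \notin A, size p < m &
  forall x y, x \in A -> y \in W -> y \notin A -> y \notin p -> ~~ e x y]].
(* The list [p] is the stack, top first. A push lowers the first term by at least 2 and raises the
   length by 1; a pop only shortens [p]. Hence the factor 2. *)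
suff H N : forall A p, st A p -> 2 * #|W :\: (A :|: [set x in p])| + size p < N -> goal.
  apply: (H _ set0 [::] _ (ltnSn _)); split; rewrite ?sub0set //.
  by split=> // x y; rewrite inE.
elim: N => // N IH A p [AW nQA sp up [pW pA szp noe]] meas.
have push y : y \in W -> y \notin A -> y \notin p -> sorted e (rev (y :: p)) -> goal.
  move=> yW yA yp syp.
  have uyp : uniq (y :: p) by rewrite /= yp.
  have sub : {subset y :: p <= W} by move=> z; rewrite inE => /orP[/eqP->|/pW].
  case: (ltnP (size p).+1 m) => szm.
    apply: (IH A (y :: p)).
      split=> //; split=> //.
        by move=> z; rewrite inE => /orP[/eqP->|/pA].
      move=> z w zA wW wA; rewrite inE negb_or => /andP[_ wp]; exact: noe.
    have: W :\: (A :|: [set x in y :: p]) \proper W :\: (A :|: [set x in p]).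
      apply/properP; split.
        apply/subsetP=> z; rewrite !inE; case: (z \in A) => //=.
        by rewrite negb_or => /andP[/andP[_ ->]].
      by exists y; rewrite !inE ?eqxx ?yW ?(negbTE yA) ?(negbTE yp) ?orbT.
    by move/proper_card; move: meas; rewrite [size (y :: p)]/=; lia.
  left; exists (rev (y :: p)); split=> //; rewrite ?rev_uniq //.
    by move=> z; rewrite mem_rev; apply: sub.
  rewrite size_rev /=; lia.
case: p sp up pW pA szp noe meas push => [|x p] sp up pW pA szp noe meas push.
  case: (set_0Vmem (W :\: A)) => [WA|[y]].
    have E : A = W by apply/eqP; rewrite eqEsubset AW -setD_eq0 WA eqxx.
    by rewrite E QW in nQA.
  rewrite inE => /andP[yA yW]; exact: (push y).
case: (pickP [pred y | [&& y \in W, y \notin A, y \notin x :: p & e x y]]) => [y|none].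
  move=> /and4P[yW yA yp exy]; apply: (push y) => //.
  by move: sp; rewrite !rev_sorted /= exy.
have xW : x \in W by apply: pW; rewrite inE eqxx.
have xA : x \notin A by apply: pA; rewrite inE eqxx.
have AxW : x |: A \subset W by rewrite subUset sub1set xW.
have noe' z w : z \in x |: A -> w \in W -> w \notin x |: A -> w \notin p -> ~~ e z w.
  rewrite !inE negb_or => zA wW /andP[wx wA] wp.
  case/orP: zA => [/eqP->|zA].
    by move: (none w); rewrite /= wW wA inE (negbTE wx) wp /= => ->.
  by apply: noe; rewrite // inE negb_or wx.
move/andP: up => [xp up].
(* Only a pop enlarges [A], so at the first time [Q] holds the popped [x] is the element whose
   removal destroys [Q], and the rest of the stack serves as [U]. *)
case: (boolP (Q (x |: A))) => QxA.
  right; exists (x |: A), [set y in p]; split=> //.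
  - by exists x; rewrite ?setU11 // setU1K.
  - have : #|[set y in p]| <= size p by rewrite cardsE; exact: card_size.
    by move: szp; rewrite [size (x :: p)]/=; lia.
  - move=> z w zA; rewrite inE inE negb_or inE => /andP[/andP[h1 h2] h3].
    exact: noe'.
apply: (IH (x |: A) p).
  split=> //.
    by move: sp; rewrite !rev_sorted /=; apply: path_sorted.
  split=> //.
  - by move=> z zp; apply: pW; rewrite inE zp orbT.
  - move=> z zp; rewrite !inE negb_or pA ?inE ?zp ?orbT // andbT.
    by apply: contraNneq xp => <-.
  - by move: szp => /=; lia.
rewrite (_ : x |: A :|: _ = A :|: [set y in x :: p]); first by move: meas; rewrite [size (x :: p)]/=; lia.
by apply/setP=> z; rewrite !inE orbCA orbA.
Qed.

(** Stopping once [s] vertices are finished leaves exactly [s] of them in [A]. At most [m] are on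
    the stack, so at least [s] vertices of [W] are left for [B]. *)
Lemma separated_pair (T : finType) (e : rel T) (W : {set T}) (s m : nat) :
  s + s + m <= #|W| -> 0 < s ->
  (exists p : seq T, [/\ sorted e p, uniq p & size p = m.+1]) \/
  (exists A B : {set T},
     [/\ A \subset W, B \subset W, s <= #|A|, s <= #|B|
       & forall x y, x \in A -> y \in B -> x != y /\ ~~ e x y]).
Proof.
move=> szW s0.
case: (@dfs_separation T e W [pred A | s <= #|A : {set T}|] m.+1) => //=.
- by rewrite cards0 -ltnNge.
- lia.
- by move=> [p [sp up _ sz]]; left; exists p.
move=> [A [U [AW sA [x xA nA] Um noe]]]; right.
exists A, (W :\: (A :|: U)); split=> //; first exact: subsetDl.
  have: #|A| <= s by move: nA; rewrite /= (cardsD1 x A) xA; lia.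
  have := (leq_card_setU A U).1.
  have := cardsD W (A :|: U).
  have := subset_leq_card (subsetIr W (A :|: U)); lia.
move=> y z yA zB; split; last exact: noe.
by apply: contraTneq zB => <-; rewrite !inE yA.
Qed.

(** Each round splits every class in two by [separated_pair]. The factor 4 pays for it: since
    [m <= s], two sets of size 4^j s and [m] stacked vertices fit into 4^(j+1) s. *)
Lemma separated_classes (T : finType) (e : rel T) (s m j : nat) (W : {set T}) :
  symmetric e -> m <= s -> 0 < s -> 4 ^ j * s <= #|W| ->
  (exists p : seq T, [/\ sorted e p, uniq p & size p = m.+1]) \/
  (exists V : nat -> {set T},
    (forall i, i < 2 ^ j -> V i \subset W /\ s <= #|V i|) /\
    (forall i i' x y, i < 2 ^ j -> i' < 2 ^ j -> i != i' ->
       x \in V i -> y \in V i' -> x != y /\ ~~ e x y)).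
Proof.
move=> esym ms s0; elim: j W => [|j IH] W szW.
  right; exists (fun=> W); split=> [i _|]; first by rewrite subxx; lia.
  by move=> [|i] [|i'].
have j4 : 0 < 4 ^ j by rewrite expn_gt0.
case: (@separated_pair T e W (4 ^ j * s) m); rewrite ?muln_gt0 ?j4 //.
- by move: szW; rewrite expnS; nia.
- by left.
move=> [A [B [AW BW sA sB AB]]].
case: (IH A sA) => [|[V1 [V1W V1s]]]; first by left.
case: (IH B sB) => [|[V2 [V2W V2s]]]; first by left.
right; exists (fun i => if i < 2 ^ j then V1 i else V2 (i - 2 ^ j)).
have lt2 i : i < 2 ^ j.+1 -> 2 ^ j <= i -> i - 2 ^ j < 2 ^ j by rewrite expnS; lia.
split=> [i li|i i' x y li li' ii'].
  case: ltnP => hi.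
    by have [V1A ?] := V1W i hi; split=> //; apply: subset_trans AW.
  by have [V2B ?] := V2W _ (lt2 _ li hi); split=> //; apply: subset_trans BW.
case: ltnP => hi; case: ltnP => hi'.
- exact: V1s.
- move=> xV yV; apply: AB.
    by apply: subsetP xV; case: (V1W i hi).
  by apply: subsetP yV; case: (V2W _ (lt2 _ li' hi')).
- move=> xV yV; rewrite eq_sym esym; apply: AB.
    by apply: subsetP yV; case: (V1W i' hi').
  by apply: subsetP xV; case: (V2W _ (lt2 _ li hi)).
- apply: V2s; [exact: lt2|exact: lt2|lia].
Qed.

(** Search along arrows from a class to the cyclically next one, until some V_i has n finished
    vertices. By minimality V_(i+1) has at most n finished vertices, and fewer than n stacked ones,
    so n of its 3n vertices are unvisited. Expansion gives an arrow into them, which the search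
    forbids; so it must have found a path instead. *)
Lemma cyclic_path (T : finType) (e : rel T) (n K : nat) (V : nat -> {set T}) :
  0 < n -> 0 < K ->
  (forall A B : {set T}, n <= #|A| -> n <= #|B| ->
     exists x y, [/\ x \in A, y \in B & e x y]) ->
  (forall i, i < K -> 3 * n <= #|V i|) ->
  (forall i i' x, i < K -> i' < K -> x \in V i -> x \in V i' -> i = i') ->
  exists (g : nat -> T) (a : nat),
    [/\ forall i j, i < j < n -> g i != g j,
        forall i, i.+1 < n -> e (g i) (g i.+1)
      & forall i, i < n -> g i \in V ((a + i) %% K)].
Proof.
move=> n0 K0 eexp Vs Vd.
pose e' := [rel x y | e x y &&
  [exists i : 'I_K, (x \in V i) && (y \in V (i.+1 %% K))]].
pose W := \bigcup_(i < K) V i.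
pose Q := [pred A : {set T} | [exists i : 'I_K, n <= #|A :&: V i|]].
case: (@dfs_separation T e' W Q n n0).
- by apply/existsPn => i; rewrite set0I cards0 -ltnNge.
- apply/existsP; exists (Ordinal K0); rewrite (setIidPr _).
    by have := Vs 0 K0; rewrite /=; lia.
  exact: (bigcup_sup (Ordinal K0)).
- move=> [[|x p] [sp up pW sz]]; first by rewrite -sz in n0.
  have /bigcupP[a _ xa] : x \in W by apply: pW; rewrite inE eqxx.
  exists (nth x (x :: p)), a.
  have st i : i.+1 < n -> e' (nth x (x :: p) i) (nth x (x :: p) i.+1).
    by move=> lin; apply: (pathP x sp); move: lin; rewrite -sz.
  split=> [i j /andP[ij jn]|i /st/andP[]//|i].
    by rewrite nth_uniq ?sz //; lia.
  elim: i => [_|i IH lin]; first by rewrite addn0 modn_small.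
  have /andP[_ /existsP[b /andP[xb yb]]] := st i lin.
  have E : nat_of_ord b = (a + i) %% K.
    by apply: Vd xb (IH (ltnW lin)) => //; rewrite ltn_mod.
  by move: yb; rewrite E -(addn1 (_ %% _)) modnDml addn1 -addnS.
move=> [A [U [AW /existsP[i iA] [x xA nQ] Un noe]]].
have iK : i.+1 %% K < K by rewrite ltn_mod.
have small : #|A :&: V (i.+1 %% K)| <= n.
  move/existsPn/(_ (Ordinal iK)): nQ => /=; rewrite -ltnNge => lt.
  rewrite (cardsD1 x (A :&: _)).
  have -> : (A :&: V (i.+1 %% K)) :\ x = (A :\ x) :&: V (i.+1 %% K).
    by rewrite setIDAC.
  by case: (x \in _); lia.
have big : n <= #|V (i.+1 %% K) :\: (A :|: U)|.
  have := Vs _ iK.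
  have := cardsD (V (i.+1 %% K)) (A :|: U).
  rewrite setIUr.
  have := (leq_card_setU (V (i.+1 %% K) :&: A) (V (i.+1 %% K) :&: U)).1.
  have := subset_leq_card (subsetIr (V (i.+1 %% K)) U).
  by move: small; rewrite setIC; lia.
have [y [z [yA zB eyz]]] := eexp _ _ iA big.
move: yA zB; rewrite !inE => /andP[yA yV] /andP[zAU zV].
have /negP[] : ~~ e' y z.
  apply: noe => //; rewrite !inE zAU /=.
  by apply/bigcupP; exists (Ordinal iK).
by rewrite /= eyz; apply/existsP; exists i; rewrite yV.
Qed.

(** * Expanding functions by counting *)

(** Bernoulli's inequality (1 + 1/b)^m >= 1 + m/b, cleared of denominators. *)
Lemma bernoulli_nat b m : b ^ m * (b + m) <= b * b.+1 ^ m.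
Proof.
elim: m => [|m IH]; first by rewrite !expn0 mul1n muln1 addn0.
rewrite !expnS; move: (b ^ m) (b.+1 ^ m) IH => X Y IH.
have : b.+1 * (X * (b + m)) <= b.+1 * (b * Y) by rewrite leq_mul2l IH.
nia.
Qed.

(** Supplies an out-degree [d] large enough for the union bound in [expander_exists]. *)
Lemma degree_exists a : 0 < a -> exists d, 4 ^ a * a.-1 ^ d < a ^ d.
Proof.
case: a => // -[_|b _]; first by exists 1; rewrite expn1 muln0.
have dbl : 2 * b.+1 ^ b.+1 <= b.+2 ^ b.+1.
  have := bernoulli_nat b.+1 b.+1.
  rewrite addnn -mul2n (mulnC 2) mulnA (mulnC (b.+1 ^ b.+1)) -mulnA leq_pmul2l //.
  by rewrite mulnC.
(* Here [a] is [b.+2]. By [dbl], each block of [b.+1] in the exponent gains a factor 2; 2a blocks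
   give 4^a and one more makes the inequality strict. *)
exists (b.+1 * (2 * b.+2).+1); rewrite !expnM (_ : 4 = 2 ^ 2) // -expnM /=.
have le := dbl; rewrite -(leq_exp2r _ _ (ltn0Sn (2 * b.+2))) expnMn in le.
by apply: leq_trans le; rewrite ltn_pmul2r ?ltn_exp2l // -expnM expn_gt0.
Qed.

Lemma subset_of_card (T : finType) (A : {set T}) m :
  m <= #|A| -> exists2 B : {set T}, B \subset A & #|B| = m.
Proof.
move=> mA; exists [set x in take m (enum A)].
  by apply/subsetP=> x; rewrite inE => /mem_take; rewrite mem_enum.
rewrite cardsE; have /card_uniqP -> : uniq (take m (enum A)) by rewrite take_uniq ?enum_uniq.
by rewrite size_takel // -cardE.
Qed.

Lemma leq_card_bigcup (I T : finType) (P : pred I) (F : I -> {set T}) :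
  #|\bigcup_(i | P i) F i| <= \sum_(i | P i) #|F i|.
Proof.
elim/big_rec2: _ => [|i m A _ le]; first by rewrite cards0.
by apply: leq_trans (leq_card_setU _ _).1 _; rewrite leq_add2l.
Qed.

(** A union bound, by counting functions. With N = a n, a fixed pair of n-sets fails for a fraction
    ((a-1)/a)^(n d) of all functions, and there are at most 4^N pairs. The failing fraction is at
    most (4^a ((a-1)/a)^d)^n < 1. *)
Lemma expander_exists (a n d : nat) :
  0 < n -> 4 ^ a * a.-1 ^ d < a ^ d ->
  exists f : 'I_(a * n) -> 'I_d -> 'I_(a * n),
  forall A B : {set 'I_(a * n)}, n <= #|A| -> n <= #|B| ->
  exists x i, x \in A /\ f x i \in B.
Proof.
move=> n0 had; set N := a * n.
have a0 : 0 < a by rewrite lt0n; apply: contraTneq had => ->; rewrite mul1n ltnn.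
(* The functions sending no point of the first set into the second. *)
pose bad (AB : {set 'I_N} * {set 'I_N}) : {set {ffun 'I_N * 'I_d -> 'I_N}} :=
  [set f in family (fun xi : 'I_N * 'I_d => if xi.1 \in AB.1 then [predC AB.2] else predT)].
have cbad (AB : {set 'I_N} * {set 'I_N}) : #|AB.1| = n -> #|AB.2| = n ->
    #|bad AB| = (N - n) ^ (n * d) * N ^ ((N - n) * d).
  move=> cA cB; rewrite cardsE card_family foldrE big_map big_enum /=.
  rewrite -(pair_bigA _ (fun x i => #|if x \in AB.1 then [predC AB.2] else predT|)) /=.
  rewrite (bigID (mem AB.1)) /=.
  rewrite (eq_bigr (fun=> (N - n) ^ d)); last first.
    move=> x xA; rewrite xA prod_nat_const card_ord; congr (_ ^ _).
    by apply/eqP; rewrite -(eqn_add2l n) subnKC ?leq_pmull // -cB cardC card_ord.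
  rewrite prod_nat_const cA [X in _ * X](eq_bigr (fun=> N ^ d)); last first.
    by move=> x xA; rewrite (negbTE xA) prod_nat_const card_ord card_ord.
  rewrite prod_nat_const -!expnM mulnC [d * n]mulnC [d * _]mulnC mulnC.
  congr (_ * _ ^ (_ * d)).
  by apply/eqP; rewrite -(eqn_add2l n) subnKC ?leq_pmull // -cA cardC card_ord.
pose D := [set AB : {set 'I_N} * {set 'I_N} | (#|AB.1| == n) && (#|AB.2| == n)].
have [f fgood] : exists f, f \notin \bigcup_(AB in D) bad AB.
  apply/existsP; rewrite -negb_forall; apply/negP=> /forallP allbad.
  have : #|[set: {ffun 'I_N * 'I_d -> 'I_N}]| <= \sum_(AB in D) #|bad AB|.
    apply: leq_trans (leq_card_bigcup _ _); apply: subset_leq_card.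
    by apply/subsetP=> f _; exact: allbad.
  rewrite (eq_bigr (fun=> (N - n) ^ (n * d) * N ^ ((N - n) * d))); last first.
    by move=> AB; rewrite inE => /andP[/eqP ? /eqP ?]; apply: cbad.
  rewrite sum_nat_const cardsT card_ffun card_prod !card_ord leqNgt => /negP[].
  have cD : #|D| <= 4 ^ N.
    apply: leq_trans (max_card _) _; rewrite card_prod -cardsT -powersetT card_powerset.
    by rewrite cardsT card_ord -expnMn.
  have nN : n <= N by rewrite leq_pmull.
  rewrite -[X in _ < _ ^ (X * d)](subnKC nN) mulnDl expnD mulnA ltn_pmul2r ?expn_gt0 ?(leq_trans n0 nN) //.
  apply: leq_ltn_trans (leq_mul cD (leqnn _)) _.
  have -> : N - n = a.-1 * n by rewrite /N -subn1 mulnBl mul1n.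
  rewrite !expnMn mulnA ltn_pmul2r ?expn_gt0 ?n0 // (mulnC n) /N !expnM -expnMn.
  by rewrite ltn_exp2r.
exists (fun x i => f (x, i)) => A B nA nB.
have [A' A'A cA] := subset_of_card nA; have [B' B'B cB] := subset_of_card nB.
have : f \notin bad (A', B').
  by apply: contra fgood => fb; apply/bigcupP; exists (A', B'); rewrite // inE cA cB !eqxx.
rewrite inE => /forallPn[[x i]] /=.
case: (boolP (x \in A')) => [xA'|_]; last by rewrite inE.
rewrite inE negbK => fB; exists x, i.
by rewrite (subsetP A'A) // (subsetP B'B).
Qed.

(** * Ramsey and Kovari-Sos-Turan *)

(** Induction on a + b: one of the two colour neighbourhoods of a vertex has at least half of
    2^(a+b) points, and that vertex extends a clique of its own colour. *)
Lemma ramsey_clique (T : finType) (c : rel T) (a b : nat) (S : {set T}) :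
  symmetric c -> 2 ^ (a + b) <= #|S| ->
  exists (o : bool) (A : {set T}), [/\ A \subset S, #|A| = (if o then a else b)
    & forall x y, x \in A -> y \in A -> x != y -> c x y = o].
Proof.
move=> csym; move: {2}(a + b) (leqnn (a + b)) => N; elim: N a b S => [|N IH] a b S.
  rewrite leqn0 addn_eq0 => /andP[/eqP-> /eqP->] _; exists true, set0.
  by rewrite sub0set cards0; split=> // x y; rewrite inE.
case: a => [|a]; first by exists true, set0; rewrite sub0set cards0; split=> // x y; rewrite inE.
case: b => [|b]; first by exists false, set0; rewrite sub0set cards0; split=> // x y; rewrite inE.
move=> abN szS.
have [x xS] : exists x, x \in S.
  by apply/card_gt0P; apply: leq_trans szS; rewrite expn_gt0.
have ext (o : bool) (A : {set T}) : A \subset [set y in S :\ x | c x y == o] ->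
    (forall x y, x \in A -> y \in A -> x != y -> c x y = o) ->
    [/\ x |: A \subset S, #|x |: A| = #|A|.+1 &
        forall u v, u \in x |: A -> v \in x |: A -> u != v -> c u v = o].
  move=> /subsetP AS Ac.
  have As y : y \in A -> [/\ y \in S, y != x & c x y = o].
    by move/AS; rewrite !inE => /andP[/andP[-> ->] /eqP].
  split.
  - by rewrite subUset sub1set xS; apply/subsetP=> y /As[].
  - rewrite cardsU1; case: (boolP (x \in A)) => // /As[_].
    by rewrite eqxx.
  move=> u v; rewrite !inE => /orP[/eqP->|uA] /orP[/eqP->|vA]; rewrite ?eqxx //.
  - by case/As: vA.
  - by case/As: uA => _ _ <-; rewrite csym.
  - exact: Ac.
have card_split : #|S| = 1 + #|[set y in S :\ x | c x y == true]| + #|[set y in S :\ x | c x y == false]|.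
  rewrite (cardsD1 x) xS -addnA -(cardsID [set y | c x y] (S :\ x)); congr (_ + (_ + _)).
    by apply: eq_card => y; rewrite !inE eqb_id.
  by apply: eq_card => y; rewrite !inE eqbF_neg andbC.
have pos : 0 < 2 ^ (a + b) by rewrite expn_gt0.
case: (leqP (2 ^ (a + b.+1)) #|[set y in S :\ x | c x y == true]|) => szT.
  have [] := IH a b.+1 _ _ szT; first by lia.
  move=> [] [A [AS cA Ac]].
    have [h1 h2 h3] := ext true A AS Ac.
    by exists true, (x |: A); split=> //; rewrite h2 cA.
  exists false, A; split=> //; apply: subset_trans AS _.
  by apply/subsetP=> y; rewrite !inE => /andP[/andP[]].
have szF : 2 ^ (a.+1 + b) <= #|[set y in S :\ x | c x y == false]|.
  by move: szS szT; rewrite card_split !addSn !addnS !expnS; lia.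
have [] := IH a.+1 b _ _ szF; first by lia.
move=> [] [A [AS cA Ac]].
  exists true, A; split=> //; apply: subset_trans AS _.
  by apply/subsetP=> y; rewrite !inE => /andP[/andP[]].
have [h1 h2 h3] := ext false A AS Ac.
by exists false, (x |: A); split=> //; rewrite h2 cA.
Qed.

Lemma biclique (T : finType) (E : rel T) (h s : nat) (A B : {set T}) :
  0 < h -> #|A| = 2 * h ^ 2 -> s = 2 * (2 ^ #|A| * h) -> #|B| = h * s ->
  (forall x, x \in A -> s <= #|[set y in B | E x y]|) ->
  exists A' B' : {set T}, [/\ A' \subset A, B' \subset B, h <= #|A'|, h <= #|B'|
    & forall x y, x \in A' -> y \in B' -> E x y].
Proof.
move=> h0 cA sE cB deg.
pose N y := [set x in A | E x y].
pose Y := [set y in B | h <= #|N y|].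
(* Double counting of edges: a point of [Y] has at most |A| neighbours, any other at most h. As |B|
   h is half of |A| s, this forces |Y| >= s/2. *)
have cnt : #|A| * s <= #|Y| * #|A| + #|B| * h.
  have -> : #|A| * s = \sum_(x in A) s by rewrite sum_nat_const.
  apply: leq_trans (_ : \sum_(x in A) \sum_(y in B | E x y) 1 <= _).
    apply: leq_sum => x xA; apply: leq_trans (deg x xA) _.
    by rewrite -sum1_card leq_eqVlt; apply/orP; left; apply/eqP/eq_bigl=> y; rewrite inE.
  rewrite (exchange_big_dep (mem B)) /=; last by move=> x y _ /andP[].
  apply: leq_trans (_ : \sum_(y in B) ((y \in Y) * #|A| + h) <= _).
    apply: leq_sum => y yB.
    have -> : \sum_(x in A | (y \in B) && E x y) 1 = #|N y|.
      by rewrite -sum1_card; apply: eq_bigl=> x; rewrite inE yB.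
    rewrite inE yB /=; case: (leqP h) => hN; rewrite ?mul1n ?mul0n; last by lia.
    have : #|N y| <= #|A| by apply: subset_leq_card; apply/subsetP=> x; rewrite inE => /andP[].
    lia.
  rewrite big_split /= sum_nat_const leq_add2r -big_distrl /= leq_mul2r; apply/orP; right.
  rewrite -big_mkcondr /= -sum1_card; apply: eq_leq.
  by apply: eq_bigl=> y; rewrite inE; case: (y \in B).
have cY : 2 ^ #|A| * h <= #|Y|.
  move: cnt; rewrite cB sE; move: (2 ^ _ * h) (#|Y|) => Z y; rewrite cA.
  have h2 : 0 < h ^ 2 by rewrite expn_gt0 h0.
  by rewrite [h * _ * h]mulnAC mulnn; move: (h ^ 2) h2 => q; nia.
(* Pigeonhole over the 2^|A| possible neighbourhoods: h points of [Y] share one, which has at least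
   h elements. *)
have [S /andP[SA Sbig]] : exists S : {set T}, (S \in powerset A) && (h <= #|[set y in Y | N y == S]|).
  apply/existsP; apply: contraLR cY => /existsPn small; rewrite -ltnNge.
  rewrite -sum1_card (partition_big N (mem (powerset A))) /=; last first.
    by move=> y _; rewrite inE; apply/subsetP=> x; rewrite inE => /andP[].
  apply: leq_ltn_trans (_ : \sum_(S in powerset A) h.-1 < _).
    apply: leq_sum => S SA; move: (small S); rewrite SA /= -ltnNge => lt.
    rewrite (_ : \sum_(i in Y | _) 1 = #|[set y in Y | N y == S]|); first by lia.
    by rewrite -sum1_card; apply: eq_bigl => y; rewrite inE.
  by rewrite sum_nat_const card_powerset ltn_pmul2l ?expn_gt0 // prednK.
rewrite inE in SA.
exists S, [set y in Y | N y == S]; split=> //.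
- by apply/subsetP=> y; rewrite !inE => /andP[/andP[]].
- have /card_gt0P[y] := leq_trans h0 Sbig.
  by rewrite !inE => /andP[/andP[_ hN] /eqP<-].
move=> x y xS; rewrite !inE => /andP[_ /eqP NS].
by move: xS; rewrite -NS inE => /andP[].
Qed.

(** * Copies of powers of paths *)

Lemma walk_path_graph n d (u v : path_graph n) :
  walk d u v -> u <= v + d /\ v <= u + d.
Proof.
have step (p : seq 'I_n) (w : 'I_n) : path (@path_adj n) w p ->
    w <= last w p + size p /\ last w p <= w + size p.
  elim: p w => [|z q IH] w /=; first by lia.
  by move=> /andP[/orP[/eqP wz|/eqP wz] /IH]; lia.
by case/existsP=> p /andP[/step + /eqP<-]; rewrite size_tuple.
Qed.

Lemma power_path_adj n k (u v : path_graph n) :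
  power_adj k u v -> (u < v <= u + k) || (v < u <= v + k).
Proof.
move=> adjuv; have uv : nat_of_ord u != v.
  by apply: contraTneq adjuv => /ord_inj->; rewrite power_adj_irr.
move: adjuv; rewrite /power_adj /dist; case: ifP => // fd /andP[_ dk].
have hw : has (fun d => walk d u v) (iota 0 #|path_graph n|).
  by rewrite has_find size_iota.
have := nth_find 0 hw; rewrite nth_iota // add0n => /walk_path_graph.
by lia.
Qed.

Lemma pick_avoiding (T : finType) (S : {set T}) (k s : nat) (X Y : 'I_k -> {set T}) :
  0 < k -> 2 * k * s <= #|S| -> (forall i, #|X i| < s) -> (forall i, #|Y i| < s) ->
  exists2 u, u \in S & forall i, u \notin X i /\ u \notin Y i.
Proof.
move=> k0 cS cX cY.
have lt : #|\bigcup_i (X i :|: Y i)| < #|S|.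
  apply: leq_ltn_trans (leq_card_bigcup _ _) _.
  apply: leq_ltn_trans (_ : \sum_(i < k) 2 * s.-1 < _).
    apply: leq_sum => i _; apply: leq_trans (leq_card_setU _ _).1 _.
    by have := cX i; have := cY i; lia.
  have s0 : 0 < s by apply: leq_ltn_trans (cX (Ordinal k0)).
  by rewrite sum_nat_const card_ord; apply: leq_trans cS; nia.
have /subsetPn[u uS uXY] : ~~ (S \subset \bigcup_i (X i :|: Y i)).
  by apply: contraL lt => /subset_leq_card; rewrite -leqNgt.
exists u => // i; apply/andP; rewrite -negb_or -in_setU.
by apply: contra uXY => uXY; apply/bigcupP; exists i.
Qed.

Section Colouring.
Variables (G : sgraph) (c : {set G} -> bool).

Definition good (b : bool) : rel G := fun u v => adj u v && (c [set u; v] == b).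

Lemma good_sym b : symmetric (good b).
Proof. by move=> u v; rewrite /good adj_sym setUC. Qed.

Lemma mono_copy_power_path k n b (f : nat -> G) :
  (forall i j, i < j < n -> f i != f j) ->
  (forall i j, i < j < n -> j <= i + k -> good b (f i) (f j)) ->
  mono_copy (power (path_graph n) k) c.
Proof.
move=> finj fgood; exists b, (fun i : 'I_n => f i); split.
  move=> i j fij; apply/ord_inj; case: (ltngtP i j) => // lt.
    by have := finj i j; rewrite lt ltn_ord fij eqxx => /(_ isT).
  by have := finj j i; rewrite lt ltn_ord fij eqxx => /(_ isT).
move=> u v /power_path_adj /orP[] /andP[uv vk].
  have /andP[-> /eqP->] : good b (f u) (f v) by apply: fgood => //; rewrite uv ltn_ord.
  by [].
have : good b (f v) (f u) by apply: fgood => //; rewrite uv ltn_ord.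
by rewrite good_sym => /andP[-> /eqP->].
Qed.

(** Vertex i goes to position i mod k of block i / k. Indices at distance at most k lie in the same
    or in consecutive blocks, so cliques joined completely in a row suffice. *)
Lemma mono_copy_blocks k n b (D : nat -> seq G) :
  0 < k -> 0 < n ->
  (forall j, j < n -> size (D j) = k /\ uniq (D j)) ->
  (forall j j' u, j < j' < n -> u \in D j -> u \notin D j') ->
  (forall j u v, j < n -> u \in D j -> v \in D j -> u != v -> good b u v) ->
  (forall j u v, j.+1 < n -> u \in D j -> v \in D j.+1 -> good b u v) ->
  mono_copy (power (path_graph n) k) c.
Proof.
move=> k0 n0 Dk Dd Din Dnext.
have [x0 _] : exists x0, x0 \in D 0.
  case: (D 0) (Dk 0 n0) => [[k00]|x s _]; first by rewrite -k00 in k0.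
  by exists x; rewrite inE eqxx.
have divlt i : i < n -> i %/ k < n by move=> lin; apply: leq_ltn_trans lin; apply: leq_div.
pose f i := nth x0 (D (i %/ k)) (i %% k).
have fD i : i < n -> f i \in D (i %/ k).
  by move=> lin; rewrite mem_nth // (Dk _ (divlt _ lin)).1 ltn_mod.
have finj i j : i < j < n -> f i != f j.
  move=> /andP[ij jn]; have lin := ltn_trans ij jn.
  have := leq_div2r k (ltnW ij); rewrite leq_eqVlt => /orP[/eqP E|lt].
    rewrite /f E nth_uniq ?(Dk _ (divlt _ jn)).1 ?(Dk _ (divlt _ jn)).2 ?ltn_mod //.
    by apply: contraTneq ij => Em; rewrite (divn_eq i k) (divn_eq j k) E Em ltnn.
  have := Dd (i %/ k) (j %/ k) (f i); rewrite lt divlt // fD // => /(_ isT isT).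
  by apply: contraNneq => ->; apply: fD.
apply: (@mono_copy_power_path k n b f) => // i j ijn jk.
have /andP[ij jn] := ijn; have lin := ltn_trans ij jn.
have := leq_div2r k (ltnW ij); rewrite leq_eqVlt => /orP[/eqP E|lt].
  by apply: (Din (j %/ k)); rewrite ?divlt ?finj ?fD // -E fD.
have E : j %/ k = (i %/ k).+1.
  apply/eqP; rewrite eqn_leq lt andbT.
  by have := leq_div2r k jk; rewrite divnDr ?dvdnn // divnn k0 addn1.
by apply: (Dnext (i %/ k)); rewrite ?fD // -E ?divlt ?fD.
Qed.

End Colouring.

(** * Colourings of the blow-up *)

Section Blowup.
Variables (V : finType) (J : rel V) (t : nat).

(** [J] is directed, so both orientations are tested; when [J] is reflexive every fibre is a clique
    on [t] vertices. *)
Definition blowup_adj : rel (V * 'I_t) :=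
  fun p q => (p != q) && (J p.1 q.1 || J q.1 p.1).

Lemma blowup_adj_sym : symmetric blowup_adj.
Proof. by move=> p q; rewrite /blowup_adj eq_sym orbC. Qed.

Lemma blowup_adj_irr : irreflexive blowup_adj.
Proof. by move=> p; rewrite /blowup_adj eqxx. Qed.

Definition blowup : sgraph := SGraph blowup_adj_sym blowup_adj_irr.

Variable c : {set blowup} -> bool.
Implicit Types (b : bool) (x y : V) (u v : 'I_t).

Definition hue x u y v : bool := c [set ((x, u) : blowup); (y, v)].

Lemma hue_sym x u y v : hue x u y v = hue y v x u.
Proof. by rewrite /hue setUC. Qed.

Variables (M : V -> {set 'I_t}) (W : {set V}) (b : bool).
Hypothesis J_refl : reflexive J.
Hypothesis M_mono : forall x u v,
  x \in W -> u \in M x -> v \in M x -> u != v -> hue x u x v = b.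

Definition linked (h : nat) : rel V := fun x y =>
  [exists A : {set 'I_t}, exists B : {set 'I_t},
    [&& A \subset M x, B \subset M y, h <= #|A|, h <= #|B|
      & [forall u in A, forall v in B, hue x u y v == b]]].

Definition link_graph (h : nat) : rel V := fun x y =>
  [&& x \in W, y \in W, x != y, J x y || J y x & linked h x y].

Lemma link_graph_sym h : symmetric (link_graph h).
Proof.
suff imp x y : link_graph h x y -> link_graph h y x by move=> x y; apply/idP/idP; apply: imp.
move=> /and5P[xW yW xy Jxy /existsP[A /existsP[B /and5P[AM BM hA hB /forall_inP ABb]]]].
apply/and5P; split; rewrite // 1?eq_sym 1?orbC //.
apply/existsP; exists B; apply/existsP; exists A; rewrite AM BM hA hB /=.
apply/forall_inP=> v vB; apply/forall_inP=> u uA.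
by have /forall_inP/(_ v vB) := ABb u uA; rewrite hue_sym.
Qed.

(** Each clique on the path receives a side of the biclique behind it and a side of the one ahead.
    Taking k vertices [L i] from the former and k others [R i] from the latter, the blocks L_0, R_0,
    L_1, R_1, ... are joined alternately inside a clique and across a biclique. Sides of size 2k
    leave room for disjointness. *)
Lemma linked_path_mono_copy k n (g : nat -> V) :
  0 < k -> 0 < n ->
  (forall i j, i < j < n.+1 -> g i != g j) ->
  (forall i, i < n -> link_graph (2 * k) (g i) (g i.+1)) ->
  mono_copy (power (path_graph n) k) c.
Proof.
move=> k0 n0 ginj glink.
have ex (xy : V * V) : exists AB : {set 'I_t} * {set 'I_t}, linked (2 * k) xy.1 xy.2 ->
    [/\ AB.1 \subset M xy.1, AB.2 \subset M xy.2, 2 * k <= #|AB.1|, 2 * k <= #|AB.2|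
      & forall u v, u \in AB.1 -> v \in AB.2 -> hue xy.1 u xy.2 v = b].
  case: (boolP (linked (2 * k) xy.1 xy.2)) => [|_]; last by exists (set0, set0).
  case/existsP=> A /existsP[B /and5P[AM BM hA hB /forall_inP ABb]].
  exists (A, B) => _; split=> // u v uA vB.
  by have /forall_inP/(_ v vB)/eqP := ABb u uA.
have [AB ABP] := fin_all_exists ex.
pose A i := (AB (g i, g i.+1)).1; pose B i := (AB (g i, g i.+1)).2.
have {}ABP i : i < n -> [/\ A i \subset M (g i), B i \subset M (g i.+1), 2 * k <= #|A i|,
    2 * k <= #|B i| & forall u v, u \in A i -> v \in B i -> hue (g i) u (g i.+1) v = b].
  by move=> lin; apply: (ABP (g i, g i.+1)); case/and5P: (glink i lin).
have gW i : i < n -> g i \in W by move=> /glink/and5P[].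
(* The first clique has no incoming biclique; its [L] is taken from [A 0]. *)
pose Lset i := if i is i'.+1 then B i' else A 0.
pose L i := take k (enum (Lset i)).
pose R i := take k (enum (A i :\: [set u in L i])).
have LsetP i : i < n -> Lset i \subset M (g i) /\ 2 * k <= #|Lset i|.
  case: i => [|i] lin; first by case: (ABP 0 lin).
  by case: (ABP i (ltnW lin)).
have LM i u : i < n -> u \in L i -> u \in M (g i).
  move=> lin /mem_take; rewrite mem_enum; apply: subsetP; exact: (LsetP i lin).1.
have RA i u : u \in R i -> u \in A i /\ u \notin L i.
  by move=> /mem_take; rewrite mem_enum !inE => /andP[].
have RM i u : i < n -> u \in R i -> u \in M (g i).
  by move=> lin /RA[uA _]; apply: subsetP uA; case: (ABP i lin).
have sL i : i < n -> size (L i) = k.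
  by move=> /LsetP[_ le]; rewrite size_takel // -cardE; lia.
have sR i : i < n -> size (R i) = k.
  move=> lin; rewrite size_takel // -cardE.
  have [_ _ hA _ _] := ABP i lin.
  have cL : #|[set u in L i]| <= k by rewrite cardsE -(sL i lin) card_size.
  have := cardsD (A i) [set u in L i].
  by have := subset_leq_card (subsetIr (A i) [set u in L i]); lia.
pose X j := if odd j then R j./2 else L j./2.
have half_lt j : j < n -> j./2 < n by lia.
have XM j u : j < n -> u \in X j -> u \in M (g j./2).
  by move=> /half_lt lj; rewrite /X; case: ifP => _; [apply: RM|apply: LM].
pose D j : seq blowup := [seq ((g j./2, u) : blowup) | u <- X j].
have pair_inj x : injective (fun u : 'I_t => ((x, u) : blowup)) by move=> u v [].
have within x u v : x \in W -> u \in M x -> v \in M x -> u != v ->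
    good c b ((x, u) : blowup) (x, v).
  move=> xW uM vM uv; rewrite /good /= /blowup_adj /= J_refl andbT.
  by rewrite (inj_eq (@pair_inj x)) uv; apply/eqP; apply: M_mono.
have Xdisj j u : ~~ odd j -> u \in X j -> u \notin X j.+1.
  move=> ev; rewrite /X /= (negbTE ev) /= uphalf_half (negbTE ev) add0n => uL.
  by apply/negP=> /RA[_]; rewrite uL.
apply: (@mono_copy_blocks blowup c k n b D) => //.
- move=> j /half_lt lj; rewrite size_map map_inj_uniq // /X.
  by case: ifP => _; rewrite ?sL ?sR // take_uniq ?enum_uniq.
- move=> j j' p /andP[jj' j'n] /mapP[u uX ->]; apply/negP=> /mapP[v vX [gE uv]].
  have E : j./2 = j'./2.
    have := half_leq (ltnW jj'); rewrite leq_eqVlt => /orP[/eqP//|lt].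
    have := ginj j./2 j'./2; rewrite lt gE eqxx ltnS (ltnW (half_lt _ j'n)).
    by move=> /(_ isT).
  have [ev jE] : ~~ odd j /\ j' = j.+1 by lia.
  by move: (Xdisj j u ev uX); rewrite -jE uv vX.
- move=> j p q jn /mapP[u uX ->] /mapP[v vX ->] uv; apply: within; rewrite ?gW ?half_lt ?XM //.
  by apply: contra uv => /eqP->.
- move=> j p q jn /mapP[u uX ->] /mapP[v vX ->].
  have jn' := ltnW jn.
  have uM := XM _ _ jn' uX; have vM := XM _ _ jn vX.
  case: (boolP (odd j)) => oj; last first.
    have E : j.+1./2 = j./2 by lia.
    rewrite E in vM *; apply: within; rewrite ?gW ?half_lt //.
    by apply: contraNneq (Xdisj j u oj uX) => ->.
  have E : j.+1./2 = j./2.+1 by lia.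
  move: uX vX; rewrite /X oddS oj E /= => /RA[uA _] /mem_take; rewrite mem_enum /= => vB.
  have lj := half_lt _ jn'.
  have /and5P[_ _ gneq Jg _] := glink _ lj.
  rewrite /good /= /blowup_adj /= Jg andbT; apply/andP; split.
    by apply: contra gneq => /eqP[->].
  by apply/eqP; case: (ABP _ lj) => _ _ _ _; apply.
Qed.

(** Without a link, fewer than [s] vertices of one clique have [s] or more [b]-neighbours in
    another, by [biclique]. Avoiding them, a greedy choice of one vertex per clique gives a copy in
    the colour [~~ b]. *)
Lemma unlinked_path_mono_copy k n s (g : nat -> V) :
  0 < k -> 0 < n -> s = 2 * (2 ^ (2 * (2 * k) ^ 2) * (2 * k)) ->
  (forall i, i < n -> #|M (g i)| = 2 * k * s) ->
  (forall i j, i < j < n -> g i != g j) ->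
  (forall i j, i < j < n -> j <= i + k ->
     J (g i) (g j) /\ ~~ linked (2 * k) (g i) (g j)) ->
  mono_copy (power (path_graph n) k) c.
Proof.
move=> k0 n0 sE cM ginj gunl.
pose nb i u j := [set v in M (g j) | hue (g i) u (g j) v == b].
pose bad i j := [set u in M (g i) | s <= #|nb i u j|].
have bad_small i j : i < j < n -> j <= i + k -> #|bad i j| < s.
  move=> ijn jk; have /andP[ij jn] := ijn.
  have [_] := gunl i j ijn jk; apply: contraR; rewrite -leqNgt => big.
  have [|A Abad cA] := @subset_of_card _ (bad i j) (2 * (2 * k) ^ 2).
    apply: leq_trans big; rewrite sE; move: (2 * (2 * k) ^ 2) => q.
    by have := ltn_expl q (ltnSn 1); move: (2 ^ q) => Z; nia.
  have [|||||A' [B' [A'A B'B hA hB ABb]]] :=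
      @biclique _ [rel u v | hue (g i) u (g j) v == b] (2 * k) s A (M (g j)).
  - by rewrite muln_gt0.
  - by [].
  - by rewrite cA.
  - exact: cM.
  - by move=> u /(subsetP Abad); rewrite inE => /andP[].
  apply/existsP; exists A'; apply/existsP; exists B'; rewrite B'B hA hB /=.
  apply/andP; split.
    apply: subset_trans A'A _; apply: subset_trans Abad _.
    by apply/subsetP=> u; rewrite inE => /andP[].
  by apply/forall_inP=> u uA; apply/forall_inP=> v vB; apply: ABb.
have [u0 _] : exists u0 : 'I_t, u0 \in M (g 0).
  by apply/card_gt0P; rewrite cM // sE !muln_gt0 expn_gt0 k0.
(* Each vertex is chosen outside the [b]-neighbourhoods of the [k] preceding
   choices and with few [b]-neighbours in each of the [k] next cliques. *)
have greedy m : m <= n -> exists v : nat -> 'I_t, forall j, j < m ->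
    [/\ v j \in M (g j),
        forall i, i < j -> j <= i + k -> hue (g i) (v i) (g j) (v j) != b
      & forall l, j < l < n -> l <= j + k -> v j \notin bad j l].
  elim: m => [_|m IH mn]; first by exists (fun=> u0).
  have [v vP] := IH (ltnW mn).
  (* Index [i] stands for offset i + 1, ahead in [X] and behind in [Y]; offsets leaving the path
     forbid nothing. *)
  pose X (i : 'I_k) := if m + i.+1 < n then bad m (m + i.+1) else set0.
  pose Y (i : 'I_k) := if i < m then nb (m - i.+1) (v (m - i.+1)) m else set0.
  have s0 : 0 < s by rewrite sE !muln_gt0 expn_gt0 k0.
  have [|i|i|u uM uXY] := @pick_avoiding _ (M (g m)) k s X Y k0.
  - by rewrite cM.
  - rewrite /X; case: ifP => [lt|_]; last by rewrite cards0.
    by apply: bad_small; have := ltn_ord i; lia.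
  - rewrite /Y; case: ifP => [lt|_]; last by rewrite cards0.
    have lm : m - i.+1 < m by lia.
    have [vM _ /(_ m)] := vP _ lm.
    rewrite inE vM /= -ltnNge; apply; first by lia.
    by have := ltn_ord i; lia.
  exists (fun i => if i == m then u else v i) => j.
  rewrite ltnS leq_eqVlt => /orP[/eqP->|jm].
    rewrite eqxx; split=> // [i im mik|l /andP[ml ln] lk].
      rewrite ltn_eqF //.
      have ik : m - i.+1 < k by lia.
      have [_] := uXY (Ordinal ik); rewrite /Y /=.
      rewrite (_ : m - i.+1 < m) ?inE ?uM; last by lia.
      by rewrite (_ : m - (m - i.+1).+1 = i) //; lia.
    have lk' : l - m.+1 < k by lia.
    have [+ _] := uXY (Ordinal lk'); rewrite /X /=.
    by rewrite (_ : m + (l - m.+1).+1 = l) ?ln //; lia.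
  have [vM vh vb] := vP j jm; rewrite ltn_eqF //; split=> // i ij.
  by rewrite ltn_eqF ?(ltn_trans ij) //; apply: vh.
have [v vP] := greedy n (leqnn n).
apply: (@mono_copy_power_path blowup c k n (~~ b) (fun i => (g i, v i))).
  by move=> i j /ginj; apply: contra => /eqP[->].
move=> i j ijn jk; have [Jij _] := gunl i j ijn jk; have /andP[ij jn] := ijn.
rewrite /good /= /blowup_adj /= Jij andbT; apply/andP; split.
  by apply: contra (ginj i j ijn) => /eqP[->].
have [_ /(_ i ij jk) + _] := vP j jn.
by rewrite /hue; case: (c _) (b) => [] [].
Qed.

End Blowup.

(** * Bounded walks and the edge count *)

Section Reach.
Variables (V I : finType) (f : V -> I -> V) (k : nat).

Definition run (x : V) (w : seq (option I)) : V :=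
  foldl (fun y o => if o is Some i then f y i else y) x w.

(* The letter [None] means waiting, so words of length exactly [k] encode
   walks of length at most [k]. *)
Definition reach : rel V := fun x y =>
  [exists w : k.-tuple (option I), run x w == y].

Lemma run_wait x m : run x (nseq m None) = x.
Proof. by elim: m. Qed.

Lemma reach_refl : reflexive reach.
Proof. by move=> x; apply/existsP; exists (nseq_tuple k None); rewrite run_wait. Qed.

Lemma reach_path (g : nat -> V) (n i j : nat) :
  (forall l, l.+1 < n -> exists a, f (g l) a = g l.+1) ->
  i <= j -> j < n -> j <= i + k -> reach (g i) (g j).
Proof.
move=> gf ij jn jk.
have word l : i + l < n -> exists2 w, size w = l & run (g i) w = g (i + l).
  elim: l => [|l IH] lt; first by exists [::]; rewrite ?addn0.
  have [|w sw rw] := IH; first by lia.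
  have [|a ga] := gf (i + l); first by lia.
  exists (rcons w (Some a)); first by rewrite size_rcons sw.
  by rewrite /run foldl_rcons -/(run _ _) rw ga addnS.
have [|w sw rw] := word (j - i); first by rewrite subnKC.
have sz : size (w ++ nseq (k - (j - i)) None) == k.
  by rewrite size_cat size_nseq sw; lia.
apply/existsP; exists (Tuple sz).
by rewrite /= /run foldl_cat -!/(run _ _) rw run_wait subnKC.
Qed.

(** An edge is determined by the base point of its tail, two fibre positions and a word of length k
    over |I| + 1 letters. *)
Lemma card_edges_blowup_reach t :
  #|edges (blowup reach t)| <= #|V| * t * t * (#|I|.+1) ^ k.
Proof.
pose phi (q : V * 'I_t * 'I_t * k.-tuple (option I)) : {set blowup reach t} :=
  [set (q.1.1.1, q.1.1.2); (run q.1.1.1 q.2, q.1.2)].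
apply: leq_trans (_ : #|phi @: setT| <= _); last first.
  apply: leq_trans (leq_imset_card _ _) _.
  by rewrite cardsT !card_prod card_tuple card_option card_ord.
apply/subset_leq_card/subsetP=> e /imset2P[[x u] [y v] _].
rewrite inE => /andP[_ /andP[_ /orP[]]] /existsP[w /eqP /= <-] ->.
  by apply/imsetP; exists (x, u, v, w).
by rewrite setUC; apply/imsetP; exists (y, v, u, w).
Qed.

End Reach.

(** * Assembly and the linear bound *)

Lemma blowup_arrows (k n d : nat) (V : finType) (f : V -> 'I_d -> V) (s r : nat) :
  0 < k -> 0 < n ->
  s = 2 * (2 ^ (2 * (2 * k) ^ 2) * (2 * k)) -> r = 2 * k * s ->
  2 * (4 ^ k * (3 * n)) <= #|V| ->
  (forall A B : {set V}, n <= #|A| -> n <= #|B| ->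
     exists x i, x \in A /\ f x i \in B) ->
  arrows (blowup (reach f k) (2 ^ (r + r))) (power (path_graph n) k).
Proof.
move=> k0 n0 sE rE cV fexp c; set t := 2 ^ (r + r) in c *.
(* The fibre size 2^(r+r) is the Ramsey bound for an r-clique in either colour. *)
have ex (x : V) : exists oM : bool * {set 'I_t}, #|oM.2| = r /\
    forall u v, u \in oM.2 -> v \in oM.2 -> u != v -> hue c x u x v = oM.1.
  have [||o [A [_ cA Ao]]] := @ramsey_clique _ (fun u v => hue c x u x v) r r [set: 'I_t].
  - by move=> u v; apply: hue_sym.
  - by rewrite cardsT card_ord.
  - by exists (o, A); rewrite cA; case: (o) Ao.
have [oM oMP] := fin_all_exists ex.
have [b cW] : exists b, 4 ^ k * (3 * n) <= #|[set x | (oM x).1 == b]|.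
  have := cardsC [set x | (oM x).1 == true].
  have -> : ~: [set x | (oM x).1 == true] = [set x | (oM x).1 == false].
    by apply/setP=> x; rewrite !inE; case: (oM x).1.
  case: (leqP (4 ^ k * (3 * n)) #|[set x | (oM x).1 == true]|) => le; first by exists true.
  by exists false; lia.
set W := [set x | _] in cW; pose M x := (oM x).2.
have Mb x u v : x \in W -> u \in M x -> v \in M x -> u != v -> hue c x u x v = b.
  by rewrite inE => /eqP<-; have [_] := oMP x; apply.
pose F := link_graph c M W b (2 * k).
(* Classes of size 3n are what [cyclic_path] asks for; the alternative is a path on n + 1 linked
   blobs. *)
have [||||[p [sp up szp]]|[Vc [VcW Vcsep]]] := @separated_classes V F (3 * n) n k W.
- exact: link_graph_sym.
- lia.
- lia.
- exact: cW.
- case: p sp up szp => // x p sp up [szp].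
  apply: (@linked_path_mono_copy _ _ _ _ M W b _ Mb k n (nth x (x :: p))) => //.
  + exact: reach_refl.
  + by move=> i j /andP[ij jn]; rewrite nth_uniq //= ?szp //; lia.
  + by move=> i lin; apply: (pathP x sp); rewrite szp.
pose e := [rel x y | [exists i, f x i == y]].
have kK : k < 2 ^ k by apply: ltn_expl.
have [||||g [a [ginj ge gV]]] := @cyclic_path V e n (2 ^ k) Vc n0.
- by rewrite expn_gt0.
- move=> A B cA cB; have [x [i [xA fB]]] := fexp A B cA cB.
  by exists x, (f x i); split=> //; apply/existsP; exists i.
- by move=> i /VcW[].
- move=> i i' x li li' xi xi'; apply/eqP/negPn/negP=> ii'.
  by have [] := Vcsep i i' x x li li' ii' xi xi'; rewrite eqxx.
apply: (@unlinked_path_mono_copy _ _ _ _ M b k n s g) => //.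
  by move=> i _; rewrite -rE; case: (oMP (g i)).
move=> i j ijn jk; have /andP[ij jn] := ijn; have lin := ltn_trans ij jn.
have Jij : reach f k (g i) (g j).
  apply: (@reach_path _ _ f k g n) => //; last exact: ltnW.
  by move=> l /ge /existsP[z /eqP gz]; exists z.
split=> //.
have lK q : q %% 2 ^ k < 2 ^ k by rewrite ltn_mod expn_gt0.
(* Positions differing by at most k < 2^k lie in different classes, hence are unlinked. *)
have neq : (a + i) %% 2 ^ k != (a + j) %% 2 ^ k.
  rewrite eqn_modDl eq_sym eqn_mod_dvd; last exact: ltnW.
  by apply/negP=> /dvdn_leq; rewrite subn_gt0 ij => /(_ isT); lia.
have [gij] := Vcsep _ _ _ _ (lK _) (lK _) neq (gV i lin) (gV j jn).
have inW q : q < n -> g q \in W.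
  by move=> lq; apply: subsetP (gV q lq); case: (VcW _ (lK (a + q))).
by apply: contra => lnk; apply/and5P; split; rewrite ?inW ?Jij.
Qed.

(** Descent on the number of edges; excluded middle decides whether an arrowing graph with fewer
    edges exists. *)
Lemma size_ramsey_attained (G H : sgraph) :
  arrows G H -> exists r, is_size_ramsey H r /\ r <= #|edges G|.
Proof.
move: {2}#|edges G| (leqnn #|edges G|) => m; elim: m G => [|m IH] G le GH.
  exists 0; split=> //; split=> //; exists G; split=> //.
  by apply/eqP; rewrite -leqn0.
case: (classic (exists2 G', arrows G' H & #|edges G'| < #|edges G|)).
  move=> [G' G'H lt]; have [|r [rH rG']] := IH G' _ G'H; first by lia.
  by exists r; split=> //; lia.
move=> none; exists #|edges G|; split=> //; split; first by exists G.
by move=> G' G'H; rewrite leqNgt; apply/negP=> lt; apply: none; exists G'.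
Qed.

Theorem theorem1p2 (k : nat) (hk : 2 <= k) :
  exists C : nat, forall n : nat, 0 < n ->
    exists r : nat, is_size_ramsey (power (path_graph n) k) r /\ r <= C * n.
Proof.
have k0 : 0 < k by apply: ltnW.
pose s := 2 * (2 ^ (2 * (2 * k) ^ 2) * (2 * k)); pose r := 2 * k * s.
(* The value of [a] makes a n equal to 2 * 4^k * 3n, the number of blobs required by
   [blowup_arrows]. *)
pose t := 2 ^ (r + r); pose a := 6 * 4 ^ k.
have [d ad] : exists d, 4 ^ a * a.-1 ^ d < a ^ d.
  by apply: degree_exists; rewrite muln_gt0 expn_gt0.
(* The edge count with a n base points, divided by n; [a], [t] and [d] are fixed before [n]. *)
exists (a * t * t * d.+1 ^ k) => n n0.
have [f fexp] := expander_exists n0 ad.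
have [|q [qmin qle]] := @size_ramsey_attained (blowup (reach f k) t) (power (path_graph n) k).
  apply: (@blowup_arrows k n d _ f s r) => //.
  by rewrite card_ord /a; lia.
exists q; split=> //; apply: leq_trans qle _.
apply: leq_trans (card_edges_blowup_reach _ _ _) _.
by rewrite !card_ord (mulnAC a n) (mulnAC _ n t) (mulnAC _ n).
Qed.
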